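(* Let $M<T$ be positive integers. For every real diagonal matrix $\bm{A}\in\mathbb{R}^{M\times M}$ with $\bm{A}\succeq\bm{0}$ and $\mathrm{tr}(\bm{A}^2)=MT$, the sensing-induced rate loss $$\Delta(\bm{A})=\Big(1-\frac{M}{T}\Big)\big(M\log_2T-\log_2\det(\bm{A}^2)\big)$$ satisfies $\Delta(\bm{A})\ge 0$, with equality if and only if $\bm{A}^2=T\bm{I}_M$.
   Context: The sensing-induced rate loss is defined as $\Delta(\bm{A})=C_{\rm pure}-T^{-1}I_{\rm lb}(\bm{A})$, where $C_{\rm pure}$ is the high-SNR rate attained by $\bm{A}=\sqrt{T}\bm{I}_M$ in a noncoherent block-fading MIMO channel with $M$ transmit antennas and coherence time $T$, and $I_{\rm lb}(\bm{A})=(T-M)\log_2\det(\bm{A}^2)+\text{const}$ is a high-SNR lower bound on the mutual information; this difference equals the closed form displayed in the claim, which is taken as the definition. When $\det\bm{A}=0$, $\log_2\det(\bm{A}^2)=-\infty$ and $\Delta(\bm{A})=+\infty$. *)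

(* Defs.v *)
From mathcomp Require Import all_boot all_order all_algebra.
From mathcomp Require Import all_reals ereal exp.

Set Implicit Arguments.
Unset Strict Implicit.
Unset Printing Implicit Defensive.

Import Order.TTheory GRing.Theory Num.Theory.

Local Open Scope ring_scope.
Local Open Scope ereal_scope.

Definition psdmx (R : realType) (n : nat) (A : 'M[R]_n) : Prop :=
  A^T%R = A /\ forall x : 'cV[R]_n, (0 <= (x^T *m A *m x) ord0 ord0)%R.

(* Extended-real valued so that log2e 0 = -oo, as inherited from [lne];
   [ln] is a junk value at 0. *)
Definition log2e (R : realType) (x : \bar R) : \bar R :=
  (ln 2)^-1%:E * lne x.

(* The value is +oo when M < T and \det A = 0. *)
Definition rate_loss (R : realType) (M T : nat) (A : 'M[R]_M) : \bar R :=
  (1 - M%:R / T%:R)%:E *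
    (M%:R%:E * log2e T%:R%:E - log2e (\det (A ^+ 2))%:E).

(* Main.v *)
(* The diagonal entries of A^2 are nonnegative with arithmetic mean T, so the
   AM-GM inequality gives det (A^2) <= T^M, with equality exactly when they are
   all equal to T; the rate loss is a positive multiple of
   ln (T^M) - ln (det (A^2)). *)
Require Import Defs.
From mathcomp Require Import all_boot all_order all_algebra.
From mathcomp Require Import all_reals ereal exp.

Import Order.TTheory GRing.Theory Num.Theory.

Local Open Scope ring_scope.
Local Open Scope ereal_scope.

Lemma det_diag_leif (R : numFieldType) (n : nat) (d : 'rV[R]_n) (t : R) :
  (forall i, (0 <= d ord0 i)%R) -> \tr (diag_mx d) = (n%:R * t)%R ->
  (\det (diag_mx d) <= t ^+ n ?= iff (diag_mx d == t%:M))%R.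
Proof.
case: n d => [|n] d d_ge0 tr_d.
  (* An empty family has no mean, so size 0 is separate: both sides are 1 and all empty matrices
     coincide, so equality holds. *)
  rewrite det_mx00 expr0; split=> //; rewrite eqxx; symmetry.
  by apply/eqP/matrixP => -[].
have sum_d : (\sum_i d ord0 i = n.+1%:R * t)%R by rewrite -mxtrace_diag.
have n_neq0 : n.+1%:R != 0%R :> R by rewrite pnatr_eq0.
have := @leif_AGM R 'I_n.+1 predT (fun i => d ord0 i) (fun i _ => d_ge0 i).
rewrite sum_d card_ord mulrC mulKf // det_diag => AGM.
(* The equality case of AM-GM only says that the entries agree pairwise; the trace then forces their
   common value to be [t]. *)
suff -> : (diag_mx d == t%:M)%R =
  [forall i in 'I_n.+1, forall j in 'I_n.+1, d ord0 i == d ord0 j] by [].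
apply/eqP/'forall_'forall_eqP => [d_t i j|d_cst].
  move/matrixP: d_t => d_t.
  by have := d_t i i; have := d_t j j; rewrite !mxE !eqxx !mulr1n => -> ->.
have d_t j : d ord0 j = t.
  apply: (mulfI n_neq0); rewrite -sum_d (eq_bigr (fun=> d ord0 j)) => [|i _].
    by rewrite sumr_const card_ord mulr_natl.
  exact: d_cst.
by apply/matrixP => i j; rewrite !mxE d_t.
Qed.

(** Since [T] is positive, the first logarithm is finite and no [+oo - oo] arises; since [M < T],
    the prefactor is strictly positive and cannot collapse [+oo] to 0. *)
Lemma rate_loss_det0 (R : realType) (M T : nat) (A : 'M[R]_M) :
  (M < T)%N -> (\det (A ^+ 2) = 0)%R -> rate_loss T A = +oo.
Proof.
move=> M_lt_T det0; have T_gt0 : (0 < T)%N by apply: leq_ltn_trans M_lt_T.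
have ln2_gt0 : (0 < (ln 2)^-1 :> R)%R by rewrite invr_gt0 ln_gt0 ?ltr1n.
rewrite /rate_loss /log2e det0 (le0_lneNy (lexx 0)) gt0_muleNy ?lte_fin //.
rewrite lne_EFin ?ltr0n // -!EFinM addey // gt0_muley //.
by rewrite lte_fin subr_gt0 ltr_pdivrMr ?ltr0n // mul1r ltr_nat.
Qed.

Lemma rate_loss_fin (R : realType) (M T : nat) (A : 'M[R]_M) :
  (0 < T)%N -> (0 < \det (A ^+ 2))%R ->
  rate_loss T A =
    ((1 - M%:R / T%:R) / ln 2 * (ln (T%:R ^+ M) - ln (\det (A ^+ 2))))%:E.
Proof.
move=> T_gt0 det_gt0; rewrite /rate_loss /log2e !lne_EFin ?ltr0n //.
rewrite -!EFinM lnXn ?ltr0n // -(mulr_natl (ln _)); congr _%:E.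
by rewrite mulrCA -mulrBr mulrA.
Qed.

Theorem theorem1 (R : realType) (M T : nat) (M_gt0 : (0 < M)%N)
    (M_lt_T : (M < T)%N) (A : 'M[R]_M) (A_diag : is_diag_mx A)
    (A_psd : psdmx A) (A_trace : \tr (A ^+ 2)%R = (M%:R * T%:R)%R) :
  0 <= rate_loss T A /\
  (rate_loss T A = 0 <-> (A ^+ 2)%R = (T%:R)%:M%R).
Proof.
have T_gt0 : (0 < T)%N by apply: leq_ltn_trans M_lt_T.
have [a defA] := diag_mxP _ A_diag.
pose d := (\row_j (a ord0 j ^+ 2))%R.
have A2E : (A ^+ 2)%R = diag_mx d.
  by rewrite defA expr2 -mulmxE mulmx_diag; congr diag_mx.
have d_ge0 i : (0 <= d ord0 i)%R by rewrite mxE sqr_ge0.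
have TM_gt0 : (0 < T%:R ^+ M :> R)%R by rewrite exprn_gt0 ?ltr0n.
have [det_le det_eq] : (\det (A ^+ 2) <= T%:R ^+ M
    ?= iff (A ^+ 2 == T%:R%:M :> 'M[R]_M))%R.
  by rewrite A2E; apply: det_diag_leif; rewrite -?A2E.
have : (0 <= \det (A ^+ 2))%R by rewrite A2E det_diag prodr_ge0.
rewrite le0r => /orP[/eqP det0 | det_gt0].
  (* Singular case: the loss is [+oo], and [A ^+ 2 = T%:R%:M] would force [0 = T ^ M]. *)
  rewrite rate_loss_det0 //; split=> //; split=> // /eqP.
  by rewrite -det_eq det0 lt_eqF.
have c_gt0 : (0 < (1 - M%:R / T%:R) / ln 2 :> R)%R.
  rewrite divr_gt0 ?ln_gt0 ?ltr1n //.
  by rewrite subr_gt0 ltr_pdivrMr ?ltr0n // mul1r ltr_nat.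
rewrite rate_loss_fin //; split.
  by rewrite lee_fin pmulr_rge0 // subr_ge0 ler_ln.
split=> [[/eqP]|/eqP].
  (* Cancelling the positive factor leaves equal logarithms of positive reals; injectivity of [ln]
     then gives the equality case of the determinant bound. *)
  rewrite mulf_eq0 gt_eqF //= subr_eq0 => /eqP/ln_inj TM_det.
  by apply/eqP; rewrite -det_eq TM_det.
by rewrite -det_eq => /eqP->; rewrite subrr mulr0.
Qed.
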